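(* Let $G$ be a Hausdorff topological group, let $(\mathbb{X},d)$ be a metric space, and let $m\colon G*\mathbb{X}\to\mathbb{X}$ be a topological partial action of $G$ on $\mathbb{X}$. Suppose that $G$ is a Baire space and that $G^x=\{g\in G\mid (g,x)\in G*\mathbb{X}\}$ is open in $G$ for every $x\in\mathbb{X}$. Then $m$ is continuous if and only if $m$ is separately continuous.
   Context: Let $G$ be a topological group with identity $1$ and $\mathbb{X}$ a topological space (here with the topology induced by the metric $d$). A (set-theoretic) partial action of $G$ on $\mathbb{X}$ is a partially defined map $m$ from $G\times\mathbb{X}$ to $\mathbb{X}$, written $m(g,x)=g\cdot x$, with domain $G*\mathbb{X}\subseteq G\times\mathbb{X}$, such that, writing $\exists\, g\cdot x$ for $(g,x)\in G*\mathbb{X}$, for all $g,h\in G$ and $x\in\mathbb{X}$: (PA1) $\exists\, g\cdot x$ implies $\exists\, g^{-1}\cdot(g\cdot x)$ and $g^{-1}\cdot(g\cdot x)=x$; (PA2) $\exists\, g\cdot(h\cdot x)$ implies $\exists\,(gh)\cdot x$ and $g\cdot(h\cdot x)=(gh)\cdot x$; (PA3) $\exists\, 1\cdot x$ and $1\cdot x=x$. For $g\in G$ put $\mathbb{X}_{g^{-1}}=\{x\in\mathbb{X}\mid \exists\, g\cdot x\}$; then $m_g\colon\mathbb{X}_{g^{-1}}\to\mathbb{X}_g$, $m_g(x)=g\cdot x$, is a bijection. The partial action is a topological partial action if each $\mathbb{X}_g$ is open in $\mathbb{X}$ and each $m_g$ is a homeomorphism. The set $G*\mathbb{X}$ carries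 the subspace topology from the product $G\times\mathbb{X}$. A topological partial action is continuous if $m\colon G*\mathbb{X}\to\mathbb{X}$ is continuous. It is separately continuous if for every $x\in\mathbb{X}$ the map $m^x\colon G^x\to\mathbb{X}$, $m^x(g)=m(g,x)$, is continuous, where $G^x=\{g\in G\mid (g,x)\in G*\mathbb{X}\}$ has the subspace topology from $G$ (each $m_g$ is already continuous by the definition of topological partial action). A space is Baire if every countable intersection of dense open subsets is dense. *)

(* Defs.v *)
From HB Require Import structures.
From mathcomp Require Import all_boot all_order all_algebra.
From mathcomp Require Import all_classical all_reals all_analysis.

Set Implicit Arguments.
Unset Strict Implicit.
Unset Printing Implicit Defensive.

Local Open Scope classical_set_scope.
Local Open Scope group_scope.

HB.mixin Record isTopologicalGroup G & Topological G & Group G := {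
  mulg_continuous : continuous (fun p : G * G => p.1 * p.2) ;
  invg_continuous : continuous (fun g : G => g^-1) }.

#[short(type="topologicalGroupType")]
HB.structure Definition TopologicalGroup :=
  {G of isTopologicalGroup G & Topological G & Group G}.

Definition baire_space (T : topologicalType) : Prop :=
  forall F : nat -> set T,
    (forall n, open (F n) /\ dense (F n)) -> dense (\bigcap_n F n).

(* The inverse [h] is a total function, but it is determined on [B] and its
   values off [B] are irrelevant. *)
Definition homeomorphism_between (T U : topologicalType)
    (A : set T) (B : set U) (f : T -> U) : Prop :=
  [/\ set_bij A B f, {within A, continuous f} &
    exists2 h : U -> T, {in A, cancel f h} & {within B, continuous h}].

(* A partially defined map is encoded by its domain [pa_dom] (the set G * X)
   together with a total function [pa_act] whose values outside the domain
   are arbitrary. *)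
Record partial_action (G : groupType) (X : Type) := PartialAction {
  pa_dom : set (G * X) ;
  pa_act : G -> X -> X ;
  pa_invK : forall g x, pa_dom (g, x) ->
    pa_dom (g^-1, pa_act g x) /\ pa_act g^-1 (pa_act g x) = x ;
  pa_comp : forall g h x, pa_dom (h, x) -> pa_dom (g, pa_act h x) ->
    pa_dom (g * h, x) /\ pa_act g (pa_act h x) = pa_act (g * h) x ;
  pa_unit : forall x, pa_dom (1, x) /\ pa_act 1 x = x }.

(* X_g; thus [pa_set m g^-1] is the set of the x such that g . x exists. *)
Definition pa_set (G : groupType) (X : Type) (m : partial_action G X) (g : G) :
  set X := [set x | pa_dom m (g^-1, x)].

(* G^x *)
Definition pa_fiber (G : groupType) (X : Type) (m : partial_action G X)
  (x : X) : set G := [set g | pa_dom m (g, x)].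

Definition topological_partial_action (G : topologicalGroupType)
    (X : topologicalType) (m : partial_action G X) : Prop :=
  (forall g, open (pa_set m g)) /\
  (forall g, homeomorphism_between (pa_set m g^-1) (pa_set m g) (pa_act m g)).

Definition continuous_partial_action (G : topologicalGroupType)
    (X : topologicalType) (m : partial_action G X) : Prop :=
  {within pa_dom m, continuous (fun p : G * X => pa_act m p.1 p.2)}.

Definition separately_continuous_partial_action (G : topologicalGroupType)
    (X : topologicalType) (m : partial_action G X) : Prop :=
  forall x, {within pa_fiber m x, continuous (fun g : G => pa_act m g x)}.

(* Main.v *)
Require Import Defs.
From mathcomp Require Import all_boot all_order all_algebra.
From mathcomp Require Import all_classical all_reals all_analysis.
Import Order.TTheory GRing.Theory Num.Theory.

(** Joint continuity restricts to separate continuity, so the content is the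
converse: if [m] is separately continuous, then [g . x] is near [g0 . x0] for
[(g, x)] near [(g0, x0)]. Writing [g . x = (g g0^-1) . (g0 . x)], where
[g0 . x] is near [g0 . x0], reduces this to [g0 = 1].

At [(1, x)], let [U] be a neighborhood of [x]. The obvious way to estimate
[g . y] is [h^-1 . ((h g) . y)], for a fixed [h] at which the action is jointly
continuous; Baire category yields many such [h]. But for a partial action
[(h g) . y] need not exist, so [h] has to be chosen after [g] and [y], and then
it must come with uniform estimates. For this [baire_cover_somewhere_dense] is
used twice:
- each [h^-1] sends some ball around [h . x] into [U], so one radius [a] serves
  a set [E] of elements [h] that is dense in a nonempty open [V1];
- inside [V1], where the orbit map may be taken to have values in an open set
  [P] of diameter less than [a], one ball [B] around [x] is sent into [P] by
  a set [F] of elements that is dense in a nonempty open [V].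

Let [v] be in [V], let [g] be so close to [1] that [v g] is in [V], and let [y]
be in [B]. The set [Q] of the [k] with [k . y] defined and in [P] is open, by
separate continuity and openness of the fibers, and it contains [F]. Density of
[F] gives [k] in [F] near [v g] with [k g^-1] in [V], and then density of [E]
gives [h] in [E] and [V] near [k g^-1] with [h g] in [Q]. Both [h . x] and
[(h g) . y] lie in [P], hence at distance less than [a], so [h^-1] is defined at
[(h g) . y] and sends it into [U]. By (PA2) the image is [g . y], which is thus
defined and in [U]. This is [near_unit_pa_act]. *)

Local Open Scope classical_set_scope.
Local Open Scope group_scope.

(** If no [U `&` E n] were somewhere dense, the complements of the closures
would be dense open sets, and their intersection would meet [U] although the
[E n] cover it. *)
Lemma baire_cover_somewhere_dense {T : topologicalType} (U : set T)
    (E : nat -> set T) :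
  baire_space T -> open U -> U !=set0 -> U `<=` \bigcup_n E n ->
  exists n, exists2 V : set T, open V /\ V !=set0 &
    V `<=` U /\ V `<=` closure (E n).
Proof.
move=> baireT openU U0 UE; apply: contrapT => noV.
have : dense (\bigcap_n ~` closure (U `&` E n)).
  apply: baireT => n; split; first exact/closed_openC/closed_closure.
  move=> O O0 openO; apply: contrapT => OF.
  have Ocl x : O x -> closure (U `&` E n) x.
    by move=> Ox; apply: contrapT => clx; apply: OF; exists x.
  apply: noV; exists n; exists (O `&` U).
    split; first exact: openI.
    case: O0 => x Ox.
    have [z [[Uz _] Oz]] := Ocl x Ox O (open_nbhs_nbhs (conj openO Ox)).
    by exists z.
  split; first by move=> x [].
  by move=> x [/Ocl + _]; apply: closureS => z [].
case/(_ U U0 openU) => x [Ux Fx].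
have [n _ Enx] := UE x Ux.
by apply: (Fx n I); apply: subset_closure.
Qed.

Lemma nbhs_ball_invn {R : realType} {X : pseudoMetricType R} (x : X)
    (U : set X) :
  nbhs x U -> exists n : nat, ball x n.+1%:R^-1%R `<=` U.
Proof.
move=> /nbhs_ballP[e /= e0 xeU].
have [k] := ltr_add_invr e0; rewrite add0r => ke.
by exists k => y /(le_ball (ltW ke)); exact: xeU.
Qed.

Lemma nbhs_invn_ball {R : realType} {X : pseudoMetricType R} (x : X) (n : nat) :
  nbhs x (ball x n.+1%:R^-1%R).
Proof. by apply: nbhsx_ballx; rewrite invr_gt0 ltr0n. Qed.

Lemma mulgl_continuous {G : topologicalGroupType} (h : G) :
  continuous (fun g : G => h * g).
Proof.
move=> g.
apply: (@continuous_comp _ _ _ (fun k => (h, k)) (fun p : G * G => p.1 * p.2)).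
  by apply: cvg_pair; [exact: cvg_cst|exact: cvg_id].
exact: mulg_continuous.
Qed.

Lemma mulgr_continuous {G : topologicalGroupType} (h : G) :
  continuous (fun g : G => g * h).
Proof.
move=> g.
apply: (@continuous_comp _ _ _ (fun k => (k, h)) (fun p : G * G => p.1 * p.2)).
  by apply: cvg_pair; [exact: cvg_id|exact: cvg_cst].
exact: mulg_continuous.
Qed.

(** The action of a single element does not see that the action is partial:
its domain is open. *)
Lemma near_pa_act {G : topologicalGroupType} {X : topologicalType}
    (m : partial_action G X) (g : G) (x : X) (U : set X) :
  topological_partial_action m -> pa_dom m (g, x) -> nbhs (pa_act m g x) U ->
  \forall y \near x, pa_dom m (g, y) /\ U (pa_act m g y).
Proof.
move=> [openm homm] dgx gxU.
have domE : pa_set m g^-1 = [set y | pa_dom m (g, y)].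
  by rewrite /pa_set invgK.
have [_ + _] := homm g; have := openm g^-1; rewrite domE => openg.
rewrite continuous_open_subspace// => /(_ x (mem_set dgx)) cg.
near=> y; split; last by near: y; exact: cg.
by near: y; exact: (open_nbhs_nbhs (conj openg dgx)).
Unshelve. all: by end_near. Qed.

Lemma near_orbit_map {G : topologicalGroupType} {X : topologicalType}
    (m : partial_action G X) (g : G) (x : X) (U : set X) :
  separately_continuous_partial_action m -> open (pa_fiber m x) ->
  pa_dom m (g, x) -> nbhs (pa_act m g x) U ->
  \forall h \near g, pa_dom m (h, x) /\ U (pa_act m h x).
Proof.
move=> /(_ x) + openx dgx gxU.
rewrite continuous_open_subspace// => /(_ g (mem_set dgx)) cx.
near=> h; split; last by near: h; exact: cx.
by near: h; exact: (open_nbhs_nbhs (conj openx dgx)).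
Unshelve. all: by end_near. Qed.

(** The domain of [m] is a neighborhood of [(1, x)] as part of the conclusion:
it is by (PA2) that [h^-1 . ((h g) . y)] shows that [g . y] exists. *)
Lemma near_unit_pa_act {R : realType} {G : topologicalGroupType}
    {X : pseudoMetricType R} (m : partial_action G X) (x : X) (U : set X) :
  topological_partial_action m -> baire_space G ->
  (forall y : X, open (pa_fiber m y)) ->
  separately_continuous_partial_action m -> nbhs x U ->
  \forall p \near ((1 : G), x), pa_dom m p /\ U (pa_act m p.1 p.2).
Proof.
move=> topm baireG fiberG sepm xU.
pose E n := [set h | forall y, ball (pa_act m h x) n.+1%:R^-1%R y ->
                       pa_dom m (h^-1, y) /\ U (pa_act m h^-1 y)].
have [||n [V1 [openV1 [v1 V1v1]] [V1x V1E]]] :=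
    @baire_cover_somewhere_dense _ (pa_fiber m x) E baireG (fiberG x).
- by exists 1; exact: (pa_unit m x).1.
- move=> h /(pa_invK (p := m))[dh hK]; move: xU; rewrite -{1}hK => xU.
  by have [n En] := nbhs_ball_invn _ _ (near_pa_act _ _ _ _ topm dh xU); exists n.
set a : R := n.+1%:R^-1%R in E V1E *.
have a2 : (0 < a / 2)%R by rewrite divr_gt0// invr_gt0 ltr0n.
pose p := pa_act m v1 x.
(* A ball of a pseudometric space need not be open, whence the interior. *)
pose P := (ball p (a / 2))°.
have openP : open P := open_interior _.
have Pp : P p by apply: nbhsx_ballx.
have Pball y z : P y -> P z -> ball y a z.
  move=> /nbhs_singleton py /nbhs_singleton pz.
  by apply: ball_split pz; exact: ball_sym.
have openPx y : open [set k | pa_dom m (k, y) /\ P (pa_act m k y)].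
  rewrite openE => k [dk Pk].
  exact: near_orbit_map (open_nbhs_nbhs (conj openP Pk)).
pose V2 := V1 `&` [set k | pa_dom m (k, x) /\ P (pa_act m k x)].
pose F l := [set h | forall y, ball x l.+1%:R^-1%R y ->
                       pa_dom m (h, y) /\ P (pa_act m h y)].
have [||l [V [openV [v Vv]] [VV2 VF]]] :=
    @baire_cover_somewhere_dense _ V2 F baireG (openI openV1 (openPx x)).
- by exists v1; split => //; split => //; exact: V1x.
- move=> h [_ [dh Ph]].
  have [l Fl] := nbhs_ball_invn _ _
    (near_pa_act _ _ _ _ topm dh (open_nbhs_nbhs (conj openP Ph))).
  by exists l.
have nbhsV k : V k -> nbhs k V by move=> Vk; exact: open_nbhs_nbhs.
have near1 : \forall g \near (1 : G), V (v * g).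
  by apply: mulgl_continuous; rewrite /= mulg1; exact: nbhsV.
exists ([set g | V (v * g)], ball x l.+1%:R^-1%R).
  by split => //; exact: nbhs_invn_ball.
move=> [g y] [/= Vvg xy].
(* The elements of [F l] near [v * g] have [y] in their domain; the condition
   on [k * g^-1] brings the second density argument back into [V]. *)
have [k [Fk [Vk Vkg]]] : F l `&` (V `&` [set k | V (k * g^-1)]) !=set0.
  apply: (VF _ Vvg); apply: filterI; first exact: nbhsV.
  by apply: mulgr_continuous; rewrite /= mulgK; exact: nbhsV.
pose Q := [set h | pa_dom m (h, y) /\ P (pa_act m h y)].
(* As [Q] is open and contains [k], it contains [h * g] for [h] near
   [k * g^-1], so that [h] can be found in the merely dense [E n]. *)
have [h [Eh [Vh [dhg Phg]]]] : E n `&`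
    (V `&` [set h | Q (h * g)]) !=set0.
  apply: (V1E _ (VV2 _ Vkg).1); apply: filterI; first exact: nbhsV.
  apply: (mulgr_continuous g (k * g^-1) Q).
  rewrite /= mulgVK; apply: open_nbhs_nbhs; split; first exact: openPx.
  exact: Fk.
have [dh Uh] := Eh _ (Pball _ _ (VV2 _ Vh).2.2 Phg).
by have [] := pa_comp dhg dh; rewrite mulKg => dg <-.
Qed.

Lemma near_pa_act_joint {R : realType} {G : topologicalGroupType}
    {X : pseudoMetricType R} (m : partial_action G X) (g : G) (x : X)
    (U : set X) :
  topological_partial_action m -> baire_space G ->
  (forall y : X, open (pa_fiber m y)) ->
  separately_continuous_partial_action m ->
  pa_dom m (g, x) -> nbhs (pa_act m g x) U ->
  \forall p \near (g, x), pa_dom m p /\ U (pa_act m p.1 p.2).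
Proof.
move=> topm baireG fiberG sepm dgx gxU.
(* Near [(1, g . x)] the action is controlled; [h . y] is reached from there as
   [(h * g^-1) . (g . y)]. *)
have [[W B] /= [W1 Bgx] WB] :=
  near_unit_pa_act m (pa_act m g x) U topm baireG fiberG sepm gxU.
exists ([set h | W (h * g^-1)],
        [set y | pa_dom m (g, y) /\ B (pa_act m g y)]).
  split; last exact: near_pa_act.
  by apply: (mulgr_continuous g^-1 g W); rewrite mulgV.
move=> [h y] [/= Wh [dgy By]].
have [/= dh Uh] := WB (_, _) (conj Wh By).
by have [] := pa_comp dgy dh; rewrite mulgVK => dhy <-.
Qed.

Lemma continuous_separately_continuous {G : topologicalGroupType}
    {X : topologicalType} (m : partial_action G X) :
  continuous_partial_action m -> separately_continuous_partial_action m.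
Proof.
move=> /subspace_continuousP cm x; apply/subspace_continuousP => g dgx U gxU.
have := cm (g, x) dgx U gxU; rewrite /= nbhs_simpl /within/= => near_gx.
have : (fun h : G => (h, x)) @ g --> (g, x).
  by apply: cvg_pair; [exact: cvg_id|exact: cvg_cst].
by move=> /(_ _ near_gx).
Qed.

Theorem theorem3p1 (R : realType) (G : topologicalGroupType)
    (X : metricType R) (m : partial_action G X)
    (G_hausdorff : hausdorff_space G)
    (m_topological : topological_partial_action m)
    (G_baire : baire_space G)
    (fiber_open : forall x : X, open (pa_fiber m x)) :
  continuous_partial_action m <-> separately_continuous_partial_action m.
Proof.
split; first exact: continuous_separately_continuous.
move=> sepm; apply/subspace_continuousP => -[g x] dgx U gxU.
have := near_pa_act_joint m g x U m_topological G_baire fiber_open sepm dgx gxU.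
by apply: filterS => q [_ Uq] _.
Qed.
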